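(* Suppose that $q\in K^*$ is not a root of unity. Then any automorphism of the algebra $T_q(2)$ is linear. Moreover, $$\mathrm{Aut}(T_q(2))\cong GL_1(K)\times GL_2(K)=K^*\times GL_2(K).$$
   Context: $K$ is a field of characteristic different from $2$. $T_q(2)$ is the unital associative $K$-algebra generated by $a_{11},a_{12},a_{22}$ with relations $a_{22}a_{12}=qa_{12}a_{22}$, $a_{11}a_{12}=qa_{12}a_{11}$, $a_{11}a_{22}=a_{22}a_{11}$. $\mathrm{Aut}(A)$ is the group of $K$-algebra automorphisms of $A$. An automorphism $\varphi\in\mathrm{Aut}(T_q(2))$ is called linear if $\varphi(\mathrm{Span}_K\{a_{11},a_{12},a_{22}\})=\mathrm{Span}_K\{a_{11},a_{12},a_{22}\}$. *)

(* Defs.v *)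
From HB Require Import structures.
From mathcomp Require Import all_boot all_order all_algebra.
From mathcomp Require Import boolp classical_sets.
From mathcomp Require Import monalg.

Set Implicit Arguments.
Unset Strict Implicit.
Unset Printing Implicit Defensive.

Import GRing.Theory.
Local Open Scope ring_scope.
Local Open Scope quotient_scope.
Local Open Scope classical_set_scope.

Inductive ideal_gen (R : nzRingType) (S : set R) : set R :=
  | IdealGen x : S x -> ideal_gen S x
  | Ideal0 : ideal_gen S 0
  | IdealB x y : ideal_gen S x -> ideal_gen S y -> ideal_gen S (x - y)
  | IdealM a x b : ideal_gen S x -> ideal_gen S (a * x * b).

Lemma malg_scaleAr (M : monomType) (R : comNzRingType) (c : R)
  (x y : {malg R[M]}) : c *: (x * y) = x * (c *: y).
Proof.
have cC (z : {malg R[M]}) : z * c%:MP = c *: z.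
  rewrite malgM_def fgmulgU malgZ_def; apply/eq_bigr => k _.
  by rewrite mulm1 mulrC.
by rewrite -cC -mulrA cC.
Qed.

(* [{fmonom 'I_3}] is the free monoid on three letters, so [freeAlg] is the
   free unital associative algebra on three generators. The letters 0, 1, 2
   stand for a_11, a_12, a_22. *)
Section QuantumTriangular.
Variables (K : fieldType) (q : K).

Local Notation freeAlg := {malg K[{fmonom 'I_3}]}.

Definition freeX (i : 'I_3) : freeAlg := << fmu i >>.
Local Notation x11 := (freeX (inord 0)).
Local Notation x12 := (freeX (inord 1)).
Local Notation x22 := (freeX (inord 2)).

Definition Tq2_rels : set freeAlg :=
  [set x22 * x12 - q *: (x12 * x22)] `|`
  [set x11 * x12 - q *: (x12 * x11)] `|`
  [set x11 * x22 - x22 * x11].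

Definition Tq2_ideal : set freeAlg := ideal_gen Tq2_rels.

Lemma Tq2_ideal_proper : ~ Tq2_ideal 1.
Proof.
pose e : freeAlg -> K := mcoeff mone.
have eB x y : e (x - y) = e x - e y by exact: raddfB.
have eM x y : e (x * y) = e x * e y by exact: rmorphM.
have eZ c x : e (c *: x) = c * e x by exact: mcoeffZ.
have eX i : e (freeX i) = 0.
  rewrite /e /freeX mcoeffU; case: eqP => // /(congr1 (@fdeg _)).
  by rewrite fdegU fdeg1.
have I0 x : Tq2_ideal x -> e x = 0.
  elim=> [y|||] /=.
  - have e0 v w c : e v = 0 -> e (v * w - c *: (w * v)) = 0.
      by move=> v0; rewrite eB eZ !eM v0 mul0r !mulr0 subr0.
    case=> [[]|] ->; [exact/e0/eX | exact/e0/eX |].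
    by rewrite -[X in _ - X]scale1r; exact/e0/eX.
  - exact: raddf0.
  - by move=> ? ? _ h1 _ h2; rewrite eB h1 h2 subr0.
  - by move=> a y b _ h; rewrite !eM h mulr0 mul0r.
by move/I0/eqP; rewrite /e rmorph1 oner_eq0.
Qed.

Lemma Tq2_idealN x : Tq2_ideal x -> Tq2_ideal (- x).
Proof. by move=> h; rewrite -sub0r; apply: IdealB => //; apply: Ideal0. Qed.

Lemma Tq2_idealD x y : Tq2_ideal x -> Tq2_ideal y -> Tq2_ideal (x + y).
Proof.
by move=> hx hy; rewrite -[y]opprK; apply: IdealB => //; apply: Tq2_idealN.
Qed.

Lemma Tq2_idealMl a x : Tq2_ideal x -> Tq2_ideal (a * x).
Proof. by move=> h; rewrite -[a * x]mulr1; apply: IdealM. Qed.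

Lemma Tq2_idealMr x b : Tq2_ideal x -> Tq2_ideal (x * b).
Proof. by move=> h; rewrite -[x]mul1r; apply: IdealM. Qed.

Lemma Tq2_idealZ c x : Tq2_ideal x -> Tq2_ideal (c *: x).
Proof. by move=> h; rewrite -mul_malgC; apply: Tq2_idealMl. Qed.

Lemma Tq2_idealBM x x' y y' : Tq2_ideal (x - x') -> Tq2_ideal (y - y') ->
  Tq2_ideal (x * y - x' * y').
Proof.
move=> hx hy; have -> : x * y - x' * y' = (x - x') * y + x' * (y - y').
  by rewrite mulrBl mulrBr addrA subrK.
by apply: Tq2_idealD; [apply: Tq2_idealMr | apply: Tq2_idealMl].
Qed.

Definition Tq2_equiv (x y : freeAlg) : bool := `[< Tq2_ideal (x - y) >].

Lemma Tq2_equiv_class : equiv_class_of Tq2_equiv.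
Proof.
split=> [x|x y|y x z].
- by apply/asboolP; rewrite subrr; apply: Ideal0.
- by apply/asboolP/asboolP => /Tq2_idealN; rewrite opprB.
- move=> /asboolP h1 /asboolP h2; apply/asboolP.
  by rewrite -[x - z](subrKA y); apply: Tq2_idealD.
Qed.

Canonical Tq2_equivRel := EquivRelPack Tq2_equiv_class.

Definition Tq2 := {eq_quot Tq2_equiv}.
HB.instance Definition _ := Choice.on Tq2.
HB.instance Definition _ := EqQuotient.on Tq2.

(* The projection and the operations are locked only to keep conversion from
   evaluating quotient representatives and monoid algebra products. *)
Definition Tq2_pi : freeAlg -> Tq2 := locked (fun x => \pi x).

Lemma Tq2_eqP x y : reflect (Tq2_ideal (x - y)) (Tq2_pi x == Tq2_pi y).
Proof. by rewrite /Tq2_pi -lock piE; apply: asboolP. Qed.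

Lemma Tq2_reprP x : Tq2_ideal (repr (Tq2_pi x) - x).
Proof. by apply/Tq2_eqP; rewrite {1}/Tq2_pi -lock reprK. Qed.

Definition Tq2_zero : Tq2 := Tq2_pi 0.
Definition Tq2_one : Tq2 := Tq2_pi 1.
Definition Tq2_opp : Tq2 -> Tq2 := locked (fun u => Tq2_pi (- repr u)).
Definition Tq2_add : Tq2 -> Tq2 -> Tq2 :=
  locked (fun u v => Tq2_pi (repr u + repr v)).
Definition Tq2_mul : Tq2 -> Tq2 -> Tq2 :=
  locked (fun u v => Tq2_pi (repr u * repr v)).
Definition Tq2_scale : K -> Tq2 -> Tq2 :=
  locked (fun c u => Tq2_pi (c *: repr u)).

Lemma Tq2_piN x : Tq2_opp (Tq2_pi x) = Tq2_pi (- x).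
Proof.
rewrite /Tq2_opp -lock; apply/eqP/Tq2_eqP; rewrite -opprD.
exact/Tq2_idealN/Tq2_reprP.
Qed.

Lemma Tq2_piD x y : Tq2_add (Tq2_pi x) (Tq2_pi y) = Tq2_pi (x + y).
Proof.
rewrite /Tq2_add -lock; apply/eqP/Tq2_eqP; rewrite opprD addrACA.
by apply: Tq2_idealD; apply: Tq2_reprP.
Qed.

Lemma Tq2_piM x y : Tq2_mul (Tq2_pi x) (Tq2_pi y) = Tq2_pi (x * y).
Proof.
rewrite /Tq2_mul -lock; apply/eqP/Tq2_eqP/Tq2_idealBM; exact: Tq2_reprP.
Qed.

Lemma Tq2_piZ c x : Tq2_scale c (Tq2_pi x) = Tq2_pi (c *: x).
Proof.
rewrite /Tq2_scale -lock; apply/eqP/Tq2_eqP; rewrite -scalerBr.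
exact/Tq2_idealZ/Tq2_reprP.
Qed.

Lemma Tq2_ind (P : Tq2 -> Prop) : (forall x, P (Tq2_pi x)) -> forall u, P u.
Proof. by rewrite /Tq2_pi -lock => h u; rewrite -[u](@reprK _ Tq2); apply: h. Qed.

Lemma Tq2_addA : associative Tq2_add.
Proof.
by elim/Tq2_ind=> x; elim/Tq2_ind=> y; elim/Tq2_ind=> z;
  rewrite !Tq2_piD addrA.
Qed.

Lemma Tq2_addC : commutative Tq2_add.
Proof.
by elim/Tq2_ind=> x; elim/Tq2_ind=> y; rewrite !Tq2_piD addrC.
Qed.

Lemma Tq2_add0 : left_id Tq2_zero Tq2_add.
Proof. by elim/Tq2_ind=> x; rewrite Tq2_piD add0r. Qed.

Lemma Tq2_addN : left_inverse Tq2_zero Tq2_opp Tq2_add.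
Proof. by elim/Tq2_ind=> x; rewrite Tq2_piN Tq2_piD addNr. Qed.

HB.instance Definition _ :=
  GRing.isZmodule.Build Tq2 Tq2_addA Tq2_addC Tq2_add0 Tq2_addN.

Lemma Tq2_mulA : associative Tq2_mul.
Proof.
by elim/Tq2_ind=> x; elim/Tq2_ind=> y; elim/Tq2_ind=> z;
  rewrite !Tq2_piM mulrA.
Qed.

Lemma Tq2_mul1l : left_id Tq2_one Tq2_mul.
Proof. by elim/Tq2_ind=> x; rewrite Tq2_piM mul1r. Qed.

Lemma Tq2_mul1r : right_id Tq2_one Tq2_mul.
Proof. by elim/Tq2_ind=> x; rewrite Tq2_piM mulr1. Qed.

Lemma Tq2_mulDl : left_distributive Tq2_mul Tq2_add.
Proof.
by elim/Tq2_ind=> x; elim/Tq2_ind=> y; elim/Tq2_ind=> z;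
  rewrite !(Tq2_piD, Tq2_piM) mulrDl.
Qed.

Lemma Tq2_mulDr : right_distributive Tq2_mul Tq2_add.
Proof.
by elim/Tq2_ind=> x; elim/Tq2_ind=> y; elim/Tq2_ind=> z;
  rewrite !(Tq2_piD, Tq2_piM) mulrDr.
Qed.

Lemma Tq2_one_neq0 : Tq2_one != Tq2_zero.
Proof. by apply/Tq2_eqP; rewrite subr0; apply: Tq2_ideal_proper. Qed.

HB.instance Definition _ := GRing.Zmodule_isNzRing.Build Tq2
  Tq2_mulA Tq2_mul1l Tq2_mul1r Tq2_mulDl Tq2_mulDr Tq2_one_neq0.

Lemma Tq2_scaleA a b u :
  Tq2_scale a (Tq2_scale b u) = Tq2_scale (a * b) u.
Proof. by elim/Tq2_ind: u => x; rewrite !Tq2_piZ scalerA. Qed.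

Lemma Tq2_scale1 : left_id 1 Tq2_scale.
Proof. by elim/Tq2_ind=> x; rewrite Tq2_piZ scale1r. Qed.

Lemma Tq2_scaleDr : right_distributive Tq2_scale +%R.
Proof.
by move=> a; elim/Tq2_ind=> x; elim/Tq2_ind=> y;
  rewrite /GRing.add /= !(Tq2_piD, Tq2_piZ) scalerDr.
Qed.

Lemma Tq2_scaleDl u : {morph Tq2_scale^~ u : a b / a + b}.
Proof.
move=> a b; elim/Tq2_ind: u => x.
by rewrite [in RHS]/GRing.add /= !(Tq2_piD, Tq2_piZ) scalerDl.
Qed.

HB.instance Definition _ := GRing.Zmodule_isLmodule.Build K Tq2
  Tq2_scaleA Tq2_scale1 Tq2_scaleDr Tq2_scaleDl.

Lemma Tq2_scaleAl c (u v : Tq2) : c *: (u * v) = (c *: u) * v.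
Proof.
elim/Tq2_ind: u => x; elim/Tq2_ind: v => y.
by rewrite /GRing.scale /GRing.mul /= !(Tq2_piM, Tq2_piZ) scalerAl.
Qed.

HB.instance Definition _ := GRing.Lmodule_isLalgebra.Build K Tq2 Tq2_scaleAl.

Lemma Tq2_scaleAr c (u v : Tq2) : c *: (u * v) = u * (c *: v).
Proof.
elim/Tq2_ind: u => x; elim/Tq2_ind: v => y.
rewrite /GRing.scale /GRing.mul /= !(Tq2_piM, Tq2_piZ); congr (Tq2_pi _).
exact: malg_scaleAr.
Qed.

HB.instance Definition _ := GRing.Lalgebra_isAlgebra.Build K Tq2 Tq2_scaleAr.

Lemma Tq2_pi_zmod : zmod_morphism Tq2_pi.
Proof. by move=> x y; rewrite -Tq2_piD -Tq2_piN. Qed.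

Lemma Tq2_pi_monoid : monoid_morphism Tq2_pi.
Proof. by split=> // x y; rewrite -Tq2_piM. Qed.

Lemma Tq2_pi_scalable : scalable Tq2_pi.
Proof. by move=> c x; rewrite -Tq2_piZ. Qed.

HB.instance Definition _ := GRing.isZmodMorphism.Build freeAlg Tq2 Tq2_pi
  Tq2_pi_zmod.
HB.instance Definition _ := GRing.isMonoidMorphism.Build freeAlg Tq2 Tq2_pi
  Tq2_pi_monoid.
HB.instance Definition _ := GRing.isScalable.Build K freeAlg Tq2 *:%R Tq2_pi
  Tq2_pi_scalable.

Definition Tq2_gen (i : 'I_3) : Tq2 := Tq2_pi (freeX i).
Definition a11 : Tq2 := Tq2_gen (inord 0).
Definition a12 : Tq2 := Tq2_gen (inord 1).
Definition a22 : Tq2 := Tq2_gen (inord 2).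

Lemma Tq2_relations :
  [/\ a22 * a12 = q *: (a12 * a22), a11 * a12 = q *: (a12 * a11)
    & a11 * a22 = a22 * a11].
Proof.
have rel x y c : Tq2_rels (x * y - c *: (y * x)) ->
    Tq2_pi x * Tq2_pi y = c *: (Tq2_pi y * Tq2_pi x).
  move=> h; rewrite -!rmorphM -linearZ.
  by apply/eqP/Tq2_eqP; apply: IdealGen.
split; [| |rewrite -[RHS]scale1r]; apply: rel.
- by left; left.
- by left; right.
- by right; rewrite scale1r.
Qed.

Definition Tq2_span : set Tq2 :=
  [set u | exists c11 c12 c22 : K, u = c11 *: a11 + c12 *: a12 + c22 *: a22].

End QuantumTriangular.

Arguments a11 {K} q.
Arguments a12 {K} q.
Arguments a22 {K} q.
Arguments Tq2_span {K} q.

Section AlgebraAutomorphisms.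
Variables (K : fieldType) (A : algType K).

Definition is_alg_aut (f : A -> A) : Prop :=
  [/\ linear f, monoid_morphism f & bijective f].

Record algAut := AlgAut {
  algAut_fun :> A -> A;
  _ : `[< is_alg_aut algAut_fun >] }.

HB.instance Definition _ := [isSub for algAut_fun].
HB.instance Definition _ := [Choice of algAut by <:].

Lemma algAutP (f : algAut) : is_alg_aut f.
Proof. exact/asboolP/(valP f). Qed.

Lemma algAut_zmod (f : algAut) : zmod_morphism f.
Proof.
by case: (algAutP f) => lf _ _ x y; rewrite addrC -scaleN1r lf scaleN1r addrC.
Qed.

Lemma algAut_scalable (f : algAut) : scalable f.
Proof.
case: (algAutP f) => lf _ _ c x; have := lf c x 0.
have f0 : f 0 = 0 by have := algAut_zmod f 0 0; rewrite !subrr.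
by rewrite f0 !addr0.
Qed.

Lemma algAut_monoid (f : algAut) : monoid_morphism f.
Proof. by case: (algAutP f). Qed.

HB.instance Definition _ (f : algAut) :=
  GRing.isZmodMorphism.Build A A f (algAut_zmod f).
HB.instance Definition _ (f : algAut) :=
  GRing.isMonoidMorphism.Build A A f (algAut_monoid f).
HB.instance Definition _ (f : algAut) :=
  GRing.isScalable.Build K A A *:%R f (@algAut_scalable f).

Lemma algAut_id_proof : `[< is_alg_aut idfun >].
Proof. by apply/asboolP; split=> //; exists idfun. Qed.

Lemma algAut_comp_proof (f g : algAut) : `[< is_alg_aut (f \o g) >].
Proof.
apply/asboolP; split.
- by move=> c x y /=; rewrite !linearP.
- by split=> [|x y] /=; rewrite ?rmorph1 ?rmorphM.
- by case: (algAutP f) (algAutP g) => _ _ bf [_ _ bg]; apply: bij_comp.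
Qed.

Lemma algAut_inv_exists (f : algAut) :
  exists g : A -> A, cancel f g /\ cancel g f.
Proof. by case: (algAutP f) => _ _ [g fK gK]; exists g. Qed.

Definition algAut_inv_fun (f : algAut) : A -> A :=
  projT1 (cid (algAut_inv_exists f)).

Lemma algAut_funK (f : algAut) : cancel f (algAut_inv_fun f).
Proof. by rewrite /algAut_inv_fun; case: cid => g []. Qed.

Lemma algAut_invK (f : algAut) : cancel (algAut_inv_fun f) f.
Proof. by rewrite /algAut_inv_fun; case: cid => g []. Qed.

Lemma algAut_inv_proof (f : algAut) : `[< is_alg_aut (algAut_inv_fun f) >].
Proof.
have fI := can_inj (algAut_funK f); have iK := algAut_invK f.
apply/asboolP; split.
- by move=> c x y; apply: fI; rewrite iK [RHS]linearP /= !iK.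
- split=> [|x y]; apply: fI; rewrite iK; first by rewrite rmorph1.
  by rewrite [RHS]rmorphM /= !iK.
- by exists f; [apply: iK | apply: algAut_funK].
Qed.

Definition algAut_one := AlgAut algAut_id_proof.
Definition algAut_mul f g := AlgAut (algAut_comp_proof f g).
Definition algAut_inv f := AlgAut (algAut_inv_proof f).

Lemma algAut_mulA : associative algAut_mul.
Proof. by move=> f g h; apply: val_inj. Qed.

Lemma algAut_mul1l : left_id algAut_one algAut_mul.
Proof. by move=> f; apply: val_inj. Qed.

Lemma algAut_mul1r : right_id algAut_one algAut_mul.
Proof. by move=> f; apply: val_inj. Qed.

Lemma algAut_mulV : left_inverse algAut_one algAut_inv algAut_mul.
Proof. by move=> f; apply/val_inj/funext => x; apply: algAut_funK. Qed.

Lemma algAut_mulVr : right_inverse algAut_one algAut_inv algAut_mul.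
Proof. by move=> f; apply/val_inj/funext => x; apply: algAut_invK. Qed.

HB.instance Definition _ := isGroup.Build algAut
  algAut_mulA algAut_mul1l algAut_mul1r algAut_mulV algAut_mulVr.

End AlgebraAutomorphisms.

(* [{unit R}] of finalg is only available for finite rings. *)
Section UnitGroup.
Variable R : unitRingType.

Record unitGroup := UnitGroup {
  unitGroup_val :> R;
  _ : unitGroup_val \is a GRing.unit }.

HB.instance Definition _ := [isSub for unitGroup_val].
HB.instance Definition _ := [Choice of unitGroup by <:].

Implicit Types u v : unitGroup.

Lemma unitGroup_mul_proof u v : (u : R) * (v : R) \is a GRing.unit.
Proof. by rewrite unitrMl ?(valP u) ?(valP v). Qed.

Lemma unitGroup_inv_proof u : (u : R)^-1 \is a GRing.unit.
Proof. by rewrite unitrV (valP u). Qed.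

Definition unitGroup_one := UnitGroup (@unitr1 R).
Definition unitGroup_mul u v := UnitGroup (unitGroup_mul_proof u v).
Definition unitGroup_inv u := UnitGroup (unitGroup_inv_proof u).

Lemma unitGroup_mulA : associative unitGroup_mul.
Proof. by move=> u v w; apply/val_inj/mulrA. Qed.

Lemma unitGroup_mul1l : left_id unitGroup_one unitGroup_mul.
Proof. by move=> u; apply/val_inj/mul1r. Qed.

Lemma unitGroup_mul1r : right_id unitGroup_one unitGroup_mul.
Proof. by move=> u; apply/val_inj/mulr1. Qed.

Lemma unitGroup_mulV : left_inverse unitGroup_one unitGroup_inv unitGroup_mul.
Proof. by move=> u; apply/val_inj/mulVr/(valP u). Qed.

Lemma unitGroup_mulVr :
  right_inverse unitGroup_one unitGroup_inv unitGroup_mul.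
Proof. by move=> u; apply/val_inj/mulrV/(valP u). Qed.

HB.instance Definition _ := isGroup.Build unitGroup
  unitGroup_mulA unitGroup_mul1l unitGroup_mul1r unitGroup_mulV
  unitGroup_mulVr.

End UnitGroup.

(* As in matrix.v, square matrices only form a unit ring in nonzero dimension,
   hence the [n.-1.+1], which is convertible to [n] for concrete [n > 0]. *)
Definition GL (n : nat) (K : fieldType) := unitGroup 'M[K]_n.-1.+1.

Definition group_isomorphic (G H : groupType) : Prop :=
  exists f : {multiplicative G -> H}, bijective f.

Definition is_linear_aut (K : fieldType) (q : K) (phi : algAut (Tq2 q)) : Prop :=
  phi @` Tq2_span q = Tq2_span q.

(* Main.v *)
(* T_q(2) is the skew polynomial ring K[x, y][z] with x = a11, z = a12 and
   y = a22, where z f(x, y) = f(x/q, y/q) z; in particular it is a domain whose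
   only units are scalars. Let phi be an automorphism. Modulo z, the relations
   xz = qzx and yz = qzy force phi(z) = 0: otherwise phi(x) = phi(y) = 0, and
   K[x, y] would be generated by one element. Hence phi(z) lies in Az, and the
   same holds for the inverse of phi, so phi(z) = cz. Then phi(x) commutes with
   z up to the factor q, so that phi(x) = x p(z) + y r(z), and similarly
   phi(y) = x p'(z) + y r'(z). Commutation of phi(x) with phi(y) gives
   p(z/q) p'(z) = p'(z/q) p(z), so p and p' are scalar multiples of a common
   polynomial, as are r and r'; since x and y are in the image of phi, these
   common factors are units of K[z]. *)
Require Import Defs.
From HB Require Import structures.
From mathcomp Require Import all_boot all_order all_algebra.
From mathcomp Require Import boolp classical_sets.
From mathcomp Require Import monalg.
Set Implicit Arguments.
Unset Strict Implicit.
Unset Printing Implicit Defensive.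
Import GRing.Theory.
Local Open Scope ring_scope.

(** * Skew polynomial rings *)

Section SkewPolynomials.
Variables (R : comNzRingType) (s : {rmorphism R -> R}).

(* An alias of [{poly R}] indexed by [s], carrying the ring structure in which
   [X a = s(a) X]. *)
Definition skew_poly (_ : {rmorphism R -> R}) := {poly R}.

Local Notation T := (map_poly s).
Implicit Types u v w : {poly R}.

(** Coefficients stand on the left of the variable. Since [X^k a = s^k(a) X^k], moving [X^k] past
    [v] applies [s] to its coefficients [k] times; the commutative product by ['X^k] then only
    shifts degrees. *)
Definition skew_mul u v : {poly R} :=
  \sum_(k < size u) u`_k *: ('X^k * iter k T v).

Lemma skew_mulEw n u v : (size u <= n)%N ->
  skew_mul u v = \sum_(k < n) u`_k *: ('X^k * iter k T v).
Proof.
move=> le_un; rewrite /skew_mul.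
rewrite (big_ord_widen n (fun k => u`_k *: ('X^k * iter k T v)) le_un).
rewrite big_mkcond; apply: eq_bigr => k _.
by case: ltnP => // ?; rewrite nth_default ?scale0r.
Qed.

Lemma skew_mulBl w : {morph skew_mul^~ w : u v / u - v}.
Proof.
move=> u v; pose n := maxn (size u) (size v).
have le_uv : (size (u - v)%R <= n)%N.
  by rewrite (leq_trans (size_polyD _ _)) ?size_polyN.
rewrite !(@skew_mulEw n) ?leq_maxl ?leq_maxr // -sumrB.
by apply: eq_bigr => k _; rewrite coefB scalerBl.
Qed.

Lemma skew_mulDl : left_distributive skew_mul +%R.
Proof.
move=> u v w; have mulN : skew_mul (- v) w = - skew_mul v w.
  have /= := skew_mulBl w 0 v; rewrite sub0r => ->.
  by have /= := skew_mulBl w 0 0; rewrite subrr => ->; rewrite subrr sub0r.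
by rewrite -[v in LHS]opprK skew_mulBl mulN opprK.
Qed.

Lemma iter_map_polyD k : {morph iter k T : u v / u + v}.
Proof. by elim: k => // k IH u v; rewrite !iterS IH rmorphD. Qed.

Lemma skew_mulDr u : {morph skew_mul u : v w / v + w}.
Proof.
move=> v w; rewrite /skew_mul -big_split; apply: eq_bigr => k _ /=.
by rewrite iter_map_polyD mulrDr scalerDr.
Qed.

Lemma skew_mulCl c v : skew_mul c%:P v = c *: v.
Proof.
by rewrite (@skew_mulEw 1) ?size_polyC ?leq_b1 // big_ord1 coefC mul1r.
Qed.

(** Both [u * 'X] and ['X * T v] are skew products with the variable, so this is associativity for
    the middle factor [X]. Together with [skew_mulXr], where the variable is the last factor, it
    carries the induction for [skew_mulA]. *)
Lemma skew_mulXl u v : skew_mul (u * 'X) v = skew_mul u ('X * T v).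
Proof.
have le_uX : (size (u * 'X)%R <= (size u).+1)%N.
  by have [->|nz_u] := eqVneq u 0; rewrite ?mul0r ?size_poly0 ?size_mulX.
rewrite (skew_mulEw _ le_uX) big_ord_recl coefMX eqxx scale0r add0r.
apply: eq_bigr => k _ /=; rewrite coefMX /=; congr (_ *: _).
have iterX : iter k T ('X * T v) = 'X * iter k T (T v).
  by elim: (k : nat) => //= j ->; rewrite rmorphM /= map_polyX.
by rewrite iterX mulrA -exprSr -iterSr.
Qed.

Lemma skew_mulXr u v : skew_mul u ('X * v) = 'X * skew_mul u v.
Proof.
rewrite /skew_mul mulr_sumr; apply: eq_bigr => k _.
have -> : iter k T ('X * v) = 'X * iter k T v.
  by elim: (k : nat) => //= j ->; rewrite rmorphM /= map_polyX.
by rewrite -scalerAr mulrCA.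
Qed.

Lemma skew_mulZl c u v : skew_mul (c *: u) v = c *: skew_mul u v.
Proof.
rewrite (skew_mulEw _ (size_scale_leq _ _)) scaler_sumr.
by apply: eq_bigr => k _; rewrite coefZ scalerA.
Qed.

Lemma map_skew_mul u v : T (skew_mul u v) = skew_mul (T u) (T v).
Proof.
rewrite (skew_mulEw _ (size_poly _ _)) rmorph_sum.
apply: eq_bigr => k _.
by rewrite -mul_polyC !rmorphM /= map_polyC map_polyXn coef_map mul_polyC -iterSr.
Qed.

Lemma skew_mul1 : right_id 1 skew_mul.
Proof.
elim/poly_ind => [|u c IH]; first by rewrite /skew_mul size_poly0 big_ord0.
rewrite skew_mulDl skew_mulXl rmorph1 skew_mulXr IH skew_mulCl mulrC.
by rewrite alg_polyC.
Qed.

Lemma skew_1mul : left_id 1 skew_mul.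
Proof. by move=> v; rewrite skew_mulCl scale1r. Qed.

Lemma skew_mulX v : skew_mul 'X v = 'X * T v.
Proof. by rewrite -['X in LHS]mul1r skew_mulXl skew_1mul. Qed.

Lemma skew_mul_fixed u v : T v = v -> skew_mul u v = u * v.
Proof.
move=> sv; have iter_v k : iter k T v = v.
  by elim: k => // k IH; rewrite iterS IH.
rewrite -[u in RHS]coefK poly_def mulr_suml.
by apply: eq_bigr => k _; rewrite iter_v scalerAl.
Qed.

Lemma skew_mulA : associative skew_mul.
Proof.
elim/poly_ind => [|u c IH] v w.
  by rewrite /skew_mul !(size_poly0, big_ord0).
rewrite !skew_mulDl !skew_mulXl !skew_mulCl skew_mulZl; congr (_ + _).
by rewrite map_skew_mul -skew_mulXr -skew_mulXl IH mulrC.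
Qed.

Lemma coef_skew_mul u v n : (skew_mul u v)`_n =
  \sum_(k < size u) u`_k * (if (n < k)%N then 0 else iter k s v`_(n - k)).
Proof.
rewrite coef_sum; apply: eq_bigr => k _; rewrite coefZ coefXnM.
case: ifP => // _; congr (_ * _).
by elim: (k : nat) (n - k)%N => //= j IH m; rewrite coef_map /= IH.
Qed.

(** Each passage of the variable past [v] produces a factor [c], so the variable of [u] is replaced
    by [c X] and an ordinary product remains. This turns commutation of eigenvectors of [T] into an
    identity between commutative polynomials. *)
Lemma skew_mul_scaled c u v : s c = c -> T v = c *: v ->
  skew_mul u v = (u \Po (c *: 'X)) * v.
Proof.
move=> sc Tv; have iterT k : iter k T v = c ^+ k *: v.
  elim: k => [|k IH]; first by rewrite expr0 scale1r.
  rewrite iterS IH -mul_polyC rmorphM /= map_polyC /= rmorphXn sc Tv.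
  by rewrite mul_polyC scalerA -exprSr.
rewrite comp_polyE mulr_suml; apply: eq_bigr => k _.
by rewrite iterT exprZn -!scalerAl -scalerAr.
Qed.

HB.instance Definition _ := GRing.Zmodule.on (skew_poly s).
HB.instance Definition _ := GRing.Zmodule_isNzRing.Build (skew_poly s)
  skew_mulA skew_1mul skew_mul1 skew_mulDl skew_mulDr (oner_neq0 {poly R}).

Lemma skew_mulE (u v : skew_poly s) : u * v = skew_mul u v.
Proof. by []. Qed.

End SkewPolynomials.

(** * Degrees of skew products over a domain *)

Section SkewDomain.
Variables (R : idomainType) (s : {rmorphism R -> R}).
Hypothesis s_inj : injective s.

(** The coefficient of the product in degree [deg u + deg v] is [lead(u) s^m(lead(v))] with
    [m = deg u], nonzero because [s] is injective. The left side of the bound is that degree, sizes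
    exceeding degrees by one. *)
Lemma size_skew_mul (u v : {poly R}) : u != 0 -> v != 0 ->
  ((size u + size v).-2 < size (skew_mul s u v))%N.
Proof.
move=> nz_u nz_v; have := nz_u.
rewrite -size_poly_gt0; case Em: (size u) => [|m] // _.
have := nz_v; rewrite -size_poly_gt0; case En: (size v) => [|n] // _.
rewrite addSn addnS /= ltnNge; apply/negP => /leq_sizeP/(_ _ (leqnn _)).
rewrite coef_skew_mul Em big_ord_recr /= big1 => [|k _]; last first.
  rewrite [v`_ _]nth_default ?En ?ltn_subRL ?ltn_add2r //.
  suff -> : iter k s 0 = 0 by rewrite if_same mulr0.
  by elim: (k : nat) => //= j ->; rewrite rmorph0.
rewrite add0r ltnNge leq_addr /= addKn => /eqP; rewrite mulf_eq0.
have -> : u`_m = lead_coef u by rewrite lead_coefE Em.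
rewrite lead_coef_eq0 (negbTE nz_u) /=.
suff -> : (iter m s v`_n == 0) = (v`_n == 0).
  have -> : v`_n = lead_coef v by rewrite lead_coefE En.
  by rewrite lead_coef_eq0 (negbTE nz_v).
elim: m {Em} => //= j <-; rewrite -[X in _ == X](rmorph0 s).
exact: inj_eq.
Qed.

Lemma skew_mul_eq1 (u v : {poly R}) : skew_mul s u v = 1 ->
  size u = 1%N /\ size v = 1%N.
Proof.
move=> uv1.
have nz_u : u != 0.
  apply: contra_eq_neq uv1 => ->; rewrite /skew_mul size_poly0 big_ord0.
  by rewrite eq_sym oner_eq0.
have nz_v : v != 0.
  apply: contra_eq_neq uv1 => ->; rewrite eq_sym.
  have := skew_mulDr s u 0 0; rewrite addr0 => /eqP.
  by rewrite -subr_eq subrr => /eqP <-; rewrite oner_eq0.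
have := size_skew_mul nz_u nz_v; rewrite uv1 size_poly1.
move: nz_u nz_v; rewrite -!size_poly_gt0.
by case: (size u) (size v) => [|[|m]] [|[|n]] //; rewrite !addnS.
Qed.

End SkewDomain.

(** * Induction on words and the universal property of the presentation *)

Section UniversalProperty.
Variables (K : fieldType) (q : K).
Local Notation A := (Tq2 q).
Local Notation x := (a11 q).
Local Notation z := (a12 q).
Local Notation y := (a22 q).

(** The free algebra is spanned by words, and every word arises from [1] by left multiplication by
    letters; both facts pass to the quotient. *)
Lemma Tq2_gen_ind (P : A -> Prop) :
  P 1 -> (forall c a b, P a -> P b -> P (c *: a + b)) ->
  (forall a, P a -> [/\ P (x * a), P (z * a) & P (y * a)]) ->
  forall a, P a.
Proof.
move=> P1 PD Pg; have PZ0 : P 0 by rewrite -[0](addNr 1) -scaleN1r; apply: PD.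
have Pgen i a : P a -> P (Tq2_gen q i * a).
  move=> /Pg[]; rewrite /a11 /a12 /a22.
  case: i => [[|[|[|//]]] lt_i3] ? ? ?; set i := Ordinal _.
  - by have -> : i = inord 0 by apply/val_inj; rewrite /= inordK.
  - by have -> : i = inord 1 by apply/val_inj; rewrite /= inordK.
  - by have -> : i = inord 2 by apply/val_inj; rewrite /= inordK.
elim/Tq2_ind => u; rewrite [u]monalgE raddf_sum.
elim/big_rec: _ => [|m a _ Pa] /=; first exact: PZ0.
have -> : << u@_m *g m >> = u@_m *: << m >> :> {malg K[{fmonom 'I_3}]}.
  apply/malgP => n; apply: (etrans (mcoeffU _ _ _)); apply/esym.
  by apply: (etrans (mcoeffZ _ _ _)); rewrite mcoeffU mulr_natr.
rewrite linearZ /=; apply: PD => // {u a Pa}.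
case: m => s; elim: s => [|i s IH].
  suff -> : << FMonom [::] >> = 1 :> {malg K[{fmonom 'I_3}]} by rewrite rmorph1.
  by congr << _ >>; apply/esym/fmoneE.
suff -> : << FMonom (i :: s) >> = freeX K i * << FMonom s >>.
  by rewrite rmorphM; apply: Pgen.
rewrite malgM_def fgmulUU mulr1; congr << _ >>.
by rewrite -[RHS]/(fmmul _ _) fmmulE fmuE.
Qed.

Section Lift.
Variables (S : nzRingType) (f : {rmorphism K -> S}) (gx gz gy : S).
Hypothesis f_central : forall c u, f c * u = u * f c.

Let g (i : 'I_3) : S := nth 0 [:: gx; gz; gy] i.
Let word (m : {fmonom 'I_3}) : S := \prod_(i <- fmonom_val m) g i.

Let word_morph : mmorphism word.
Proof.
split=> [m n|]; last by rewrite /word fm1 big_nil.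
by rewrite /word fmM big_cat.
Qed.

HB.instance Definition _ := monalg.isMultiplicative.Build _ _ word word_morph.

(** Evaluation of words at the three given elements kills the ideal of relations and so descends to
    the quotient. Scalars act through a central morphism [f], which lets [S] be the skew polynomial
    ring as well as [A] itself. *)
Lemma Tq2_lift :
  gy * gz = f q * (gz * gy) -> gx * gz = f q * (gz * gx) -> gx * gy = gy * gx ->
  exists F : {rmorphism A -> S},
    [/\ forall c a, F (c *: a) = f c * F a, F x = gx, F z = gz & F y = gy].
Proof.
move=> rel1 rel2 rel3.
have [g0 g1 g2] : [/\ g (inord 0) = gx, g (inord 1) = gz & g (inord 2) = gy].
  by rewrite /g !inordK.
have [G [GB [GM G1] GZ GX]] : exists G : {malg K[{fmonom 'I_3}]} -> S,
    [/\ forall u v, G (u - v) = G u - G v, multiplicative G,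
        forall c u, G (c *: u) = f c * G u & forall i, G (freeX K i) = g i].
  exists (mmap f word); split.
  - exact: mmapB.
  - by apply: commr_mmap_is_multiplicative => *; apply: f_central.
  - exact: mmapZ.
  - by move=> i; rewrite mmapU /= rmorph1 mul1r /word fmU big_seq1.
have Gideal u : Tq2_ideal q u -> G u = 0.
  elim=> [v|||].
  - have G0 i j c : g i * g j = f c * (g j * g i) ->
        G (freeX K i * freeX K j - c *: (freeX K j * freeX K i)) = 0.
      move=> gij; rewrite GB; apply/eqP; rewrite subr_eq0; apply/eqP.
      apply: (etrans (GM _ _)); apply/esym; apply: (etrans (GZ _ _)).
      by rewrite [G (_ * _)]GM (GX i) (GX j) gij.
    case=> [[]|] ->; [apply: G0; rewrite g1 g2 // | apply: G0; rewrite g0 g1 // |].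
    (* The third relation takes the shape of the other two with scalar [1]. *)
    by rewrite -[X in _ - X]scale1r; apply: G0; rewrite rmorph1 mul1r g0 g2.
  - by rewrite -(subrr 0) GB subrr.
  - by move=> v w _ Gv _ Gw; rewrite GB Gv Gw subrr.
  - by move=> v w t _ Gw; rewrite !GM Gw mulr0 mul0r.
have [F FE] : exists F : A -> S, forall u, F (Tq2_pi q u) = G u.
  exists (fun a => G (repr a)) => u.
  by apply/eqP; rewrite -subr_eq0 -GB Gideal //; apply: Tq2_reprP.
have piB u v : Tq2_pi q (u - v) = Tq2_pi q u - Tq2_pi q v by exact: raddfB.
have piM u v : Tq2_pi q (u * v) = Tq2_pi q u * Tq2_pi q v by exact: rmorphM.
have pi1 : Tq2_pi q 1 = 1 by exact: rmorph1.
have piZ c u : Tq2_pi q (c *: u) = c *: Tq2_pi q u by exact: linearZ.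
have FB : zmod_morphism F.
  by elim/Tq2_ind=> u; elim/Tq2_ind=> v; rewrite -piB !FE GB.
have FM : monoid_morphism F.
  split; first by rewrite -pi1 FE G1.
  by elim/Tq2_ind=> u; elim/Tq2_ind=> v; rewrite -piM !FE GM.
pose F1 := GRing.isZmodMorphism.Build A S F FB.
pose F2 := GRing.isMonoidMorphism.Build A S F FM.
pose F' : {rmorphism A -> S} := HB.pack F F1 F2.
exists F'; split=> /=; rewrite -?g0 -?g1 -?g2; last 3 first.
1-3: exact: etrans (FE _) (GX _).
by move=> c; elim/Tq2_ind=> u; rewrite -piZ !FE GZ.
Qed.

End Lift.
End UniversalProperty.

(** * Normal forms: embedding into skew polynomials over [K[x, y]] *)

Lemma scaled_commX (K : fieldType) (A : algType K) (a b : A) (c : K) n :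
  b * a = c *: (a * b) -> b * a ^+ n = c ^+ n *: (a ^+ n * b).
Proof.
move=> ba; elim: n => [|n IH]; first by rewrite !expr0 scale1r mulr1 mul1r.
rewrite (exprSr a) mulrA IH -scalerAl -(mulrA _ b) ba -scalerAr scalerA.
by rewrite mulrA -!exprSr.
Qed.

Lemma coef_comp_scaleX (R : comNzRingType) (c : R) (p : {poly R}) n :
  (p \Po (c *: 'X))`_n = c ^+ n * p`_n.
Proof.
rewrite comp_polyE coef_sum.
under eq_bigr do rewrite exprZn scalerA coefZ coefXn.
have [le_p|lt_p] := leqP (size p) n.
  rewrite nth_default // mulr0 big1 // => i _.
  by rewrite gtn_eqF ?mulr0 // (leq_trans (ltn_ord i)).
rewrite (bigD1 (Ordinal lt_p)) //= eqxx mulr1 mulrC big1 ?addr0 // => i ne_i.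
by rewrite eq_sym -val_eqE in ne_i; rewrite (negbTE ne_i) mulr0.
Qed.

Section NormalForm.
Variables (K : fieldType) (q : K).
Hypothesis q_neq0 : q != 0.
Local Notation A := (Tq2 q).
Local Notation x := (a11 q).
Local Notation z := (a12 q).
Local Notation y := (a22 q).
Local Notation P := {poly {poly K}}.

Lemma mul_a12_monom i j k :
  z * (x ^+ i * y ^+ j * z ^+ k) =
  q^-1 ^+ (i + j) *: (x ^+ i * y ^+ j * z ^+ k.+1).
Proof.
have [yz xz _] := Tq2_relations q.
have zx : z * x = q^-1 *: (x * z) by rewrite xz scalerA mulVf ?scale1r.
have zy : z * y = q^-1 *: (y * z) by rewrite yz scalerA mulVf ?scale1r.
rewrite !mulrA (scaled_commX _ zx) -!scalerAl -(mulrA _ z) (scaled_commX _ zy).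
by rewrite -scalerAr -!scalerAl scalerA -exprD exprS !mulrA.
Qed.

(** The span of the ordered monomials contains [1] and is stable under left multiplication by each
    generator. *)
Lemma Tq2_monom_ind (Q : A -> Prop) :
  (forall c a b, Q a -> Q b -> Q (c *: a + b)) ->
  (forall i j k, Q (x ^+ i * y ^+ j * z ^+ k)) -> forall a, Q a.
Proof.
(* The predicate is generalised, because the product step applies the hypothesis on [a] to
   [fun b => Q (g * b)] for each generator [g]. *)
move=> QD Qm a; elim/Tq2_gen_ind: a Q QD Qm => [|c a b IHa IHb|a IH].
- by move=> Q _ Qm; have := Qm 0 0 0; rewrite !expr0 !mulr1.
- by move=> Q QD Qm; apply: (QD); [exact: IHa|exact: IHb].
have [_ _ xy] := Tq2_relations q.
have Q0 (Q : A -> Prop) : (forall c a b, Q a -> Q b -> Q (c *: a + b)) ->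
    (forall i j k, Q (x ^+ i * y ^+ j * z ^+ k)) -> Q 0.
  by move=> QD Qm; rewrite -(addNr 1) -scaleN1r; apply: (QD);
    have := Qm 0 0 0; rewrite !expr0 !mulr1.
split=> Q QD Qm; apply: (IH (fun b => Q (_ * b))) => [c u v ? ?|i j k].
- by rewrite mulrDr -scalerAr; apply: (QD).
- by rewrite !mulrA -exprS.
- by rewrite mulrDr -scalerAr; apply: (QD).
- by rewrite mul_a12_monom -[_ *: _]addr0; apply: (QD) => //; apply: (Q0).
- by rewrite mulrDr -scalerAr; apply: (QD).
rewrite !mulrA; have -> : y * x ^+ i = x ^+ i * y by apply/commrX.
by rewrite -(mulrA _ y) -exprS.
Qed.

(* Moving [z] past [f(x, y)] replaces it by [f(q^-1 x, q^-1 y)]. *)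
Definition twist : {rmorphism P -> P} :=
  locked (comp_poly ((q^-1)%:P *: 'X) \o map_poly (comp_poly (q^-1 *: 'X))
          : {rmorphism P -> P}).

Lemma coef_twist f i j : (twist f)`_j`_i = q^-1 ^+ (i + j) * f`_j`_i.
Proof.
rewrite /twist -lock /= coef_comp_scaleX -polyC_exp mul_polyC coefZ coef_map.
by rewrite coef_comp_scaleX mulrA -exprD addnC.
Qed.

Lemma twist_inj : injective twist.
Proof.
move=> f g eq_fg; apply/polyP => j; apply/polyP => i.
have := coef_twist f i j; rewrite eq_fg coef_twist.
by move/mulfI => -> //; rewrite expf_neq0 ?invr_eq0.
Qed.

Local Notation B := (skew_poly twist).

Lemma twistC c : twist c%:P%:P = c%:P%:P.
Proof. by rewrite /twist -lock /= map_polyC /= !comp_polyC. Qed.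

Lemma map_twistC c : map_poly twist c%:P%:P%:P = c%:P%:P%:P.
Proof. by rewrite map_polyC /= twistC. Qed.

(** In [P] the inner variable stands for [x] and the outer one for [y]; the skew variable stands for
    [z]. The relations hold there since [twist] scales both variables of [P] by [q^-1]. Values are
    typed in [{poly P}], which keeps the lemmas on ordinary polynomials available. *)
Lemma normal_form_exists : exists nf : A -> {poly P},
  [/\ {morph nf : a b / a + b}, forall c a, nf (c *: a) = c%:P%:P%:P * nf a,
      nf 1 = 1, {morph nf : a b / a * b >-> skew_mul twist a b} &
      [/\ nf x = 'X%:P%:P, nf z = 'X & nf y = 'X%:P]].
Proof.
pose f : K -> B := fun c => c%:P%:P%:P.
have f1 : zmod_morphism f by move=> c d; rewrite /f !rmorphB.
have f2 : monoid_morphism f.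
  split=> [|c d]; first by rewrite /f !rmorph1.
  by rewrite /f skew_mulE skew_mul_fixed ?map_twistC // !rmorphM.
pose F1 := GRing.isZmodMorphism.Build K B f f1.
pose F2 := GRing.isMonoidMorphism.Build K B f f2.
pose f' : {rmorphism K -> B} := HB.pack f F1 F2.
have f_central c u : f' c * u = u * f' c.
  rewrite !skew_mulE /= /f skew_mulCl [RHS]skew_mul_fixed ?map_twistC //.
  by rewrite -mul_polyC mulrC.
have mulX (a : P) : skew_mul twist 'X a%:P = (twist a)%:P * 'X.
  by rewrite skew_mulX map_polyC mulrC.
have twistX : q%:P%:P * twist 'X = 'X.
  rewrite /twist -lock /= map_polyX comp_polyX -mul_polyC mulrA -!polyCM.
  by rewrite mulfV // !polyC1 mul1r.
have twistX' : q%:P%:P * twist 'X%:P = 'X%:P.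
  rewrite /twist -lock /= map_polyC /= comp_polyC comp_polyX -polyCM.
  by rewrite -mul_polyC mulrA -polyCM mulfV // !polyC1 mul1r.
have [|||F [FZ Fx Fz Fy]] := @Tq2_lift K q B f' 'X%:P%:P 'X 'X%:P f_central.
- rewrite !skew_mulE mulX /= [RHS]skew_mulCl -mul_polyC mulrA -polyCM twistX.
  by rewrite skew_mul_fixed ?map_polyX.
- rewrite !skew_mulE mulX /= [RHS]skew_mulCl -mul_polyC mulrA -polyCM twistX'.
  by rewrite skew_mul_fixed ?map_polyX.
- by rewrite !skew_mulE !skew_mulCl -!mul_polyC mulrC.
exists F; split; last by rewrite Fx Fz Fy.
- by move=> a b; apply: (rmorphD F a b).
- by move=> c a; rewrite FZ skew_mulE skew_mulCl mul_polyC.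
- exact: (rmorph1 F).
- by move=> a b; apply: (rmorphM F a b).
Qed.

Definition nf : A -> {poly P} := projT1 (cid normal_form_exists).

Lemma nfD : {morph nf : a b / a + b}.
Proof. by rewrite /nf; case: cid => ? []. Qed.
Lemma nfZ c a : nf (c *: a) = c%:P%:P%:P * nf a.
Proof. by rewrite /nf; case: cid => ? []. Qed.
Lemma nf1 : nf 1 = 1.
Proof. by rewrite /nf; case: cid => ? []. Qed.
Lemma nfM : {morph nf : a b / a * b >-> skew_mul twist a b}.
Proof. by rewrite /nf; case: cid => ? []. Qed.
Lemma nf_gen : [/\ nf x = 'X%:P%:P, nf z = 'X & nf y = 'X%:P].
Proof. by rewrite /nf; case: cid => ? []. Qed.
Lemma nf0 : nf 0 = 0.
Proof. by rewrite -[X in nf X](scale0r 1) nfZ !polyC0 mul0r. Qed.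

Lemma nf_mulCl a b c : nf a = c%:P -> nf (a * b) = c%:P * nf b.
Proof. by move=> nfa; rewrite nfM nfa skew_mulCl mul_polyC. Qed.

Lemma nf_mul_a12 a : nf (a * z) = nf a * 'X.
Proof. by have [_ nfz _] := nf_gen; rewrite nfM nfz skew_mul_fixed ?map_polyX. Qed.

Lemma nf_exp_const a c n : nf a = c%:P -> nf (a ^+ n) = (c ^+ n)%:P.
Proof.
move=> nfa; elim: n => [|n IH]; first by rewrite !expr0 nf1.
by rewrite exprS (nf_mulCl _ nfa) IH -polyCM -exprS.
Qed.

Lemma nf_monom i j k : nf (x ^+ i * y ^+ j * z ^+ k) = ('X^i%:P * 'X^j)%:P * 'X^k.
Proof.
have [nfx _ nfy] := nf_gen; elim: k => [|k IH].
  rewrite !expr0 !mulr1 (nf_mulCl _ (nf_exp_const _ nfx)).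
  by rewrite (nf_exp_const _ nfy) polyCM !rmorphXn.
by rewrite exprSr mulrA nf_mul_a12 IH -mulrA -exprSr.
Qed.

Definition poly_xy (f : P) : A := (map_poly (horner_alg x) f).[y].

Lemma poly_xyD : {morph poly_xy : f g / f + g}.
Proof. by move=> f g; rewrite /poly_xy rmorphD hornerD. Qed.

Lemma poly_xyZ c f : poly_xy (c%:P%:P * f) = c *: poly_xy f.
Proof.
rewrite /poly_xy rmorphM /= map_polyC /= hornerCM horner_algC.
by rewrite -scalerAl mul1r.
Qed.

Lemma poly_xy_monom i j : poly_xy ('X^i%:P * 'X^j) = x ^+ i * y ^+ j.
Proof.
rewrite /poly_xy rmorphM /= map_polyC /= map_polyXn hornerCM hornerXn.
by rewrite rmorphXn /= horner_algX.
Qed.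

(** Horner evaluation leaves coefficients on the left of the powers of [z], so the normal form of an
    ordered monomial goes back to that monomial. *)
Definition of_nf (v : {poly P}) : A := (map_poly poly_xy v).[z].

Lemma poly_xy0 : poly_xy 0 = 0.
Proof. by rewrite /poly_xy rmorph0 horner0. Qed.

Lemma coef_map_xy v k : (map_poly poly_xy v)`_k = poly_xy v`_k.
Proof. exact: coef_map_id0 poly_xy0. Qed.

Lemma of_nfD : {morph of_nf : v w / v + w}.
Proof.
move=> v w; rewrite /of_nf -hornerD; congr (_.[_]).
by apply/polyP => k; rewrite coefD !coef_map_xy coefD poly_xyD.
Qed.

(** Both maps are additive and compatible with scalars, so it is enough to compare on ordered
    monomials, which span [A]. *)
Lemma nfK : cancel nf of_nf.
Proof.
apply: Tq2_monom_ind => [c a b IHa IHb|i j k].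
  rewrite nfD nfZ of_nfD IHb; congr (_ + _); rewrite -[in RHS]IHa /of_nf.
  rewrite -mulr_algl -hornerCM; congr (_.[_]).
  by apply/polyP => n; rewrite coef_map_xy !coefCM coef_map_xy poly_xyZ mulr_algl.
rewrite nf_monom /of_nf -poly_xy_monom.
have -> : map_poly poly_xy (('X^i%:P * 'X^j)%:P * 'X^k) =
    (poly_xy ('X^i%:P * 'X^j))%:P * 'X^k.
  apply/polyP => n; rewrite coef_map_xy !coefCM !coefXn.
  by case: eqP => _; rewrite ?mulr1 // !mulr0 poly_xy0.
by rewrite hornerCM hornerXn.
Qed.

Lemma nf_inj : injective nf.
Proof. exact: can_inj nfK. Qed.

End NormalForm.

(** * Reduction modulo [a12], units, and the image of [a12] *)

Section Structure.
Variables (K : fieldType) (q : K).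
Hypothesis q_neq0 : q != 0.
Hypothesis q_not_root_of_unity : forall n, (0 < n)%N -> q ^+ n != 1.
Local Notation A := (Tq2 q).
Local Notation x := (a11 q).
Local Notation z := (a12 q).
Local Notation y := (a22 q).
Local Notation P := {poly {poly K}}.
Local Notation nf := (nf q_neq0).
Local Notation h := (horner_alg z).
Local Notation C2 := (map_poly (polyC \o polyC)).

Lemma expq_inj i j : q ^+ i = q ^+ j -> i = j.
Proof.
wlog le_ij : i j / (i <= j)%N.
  by move=> W eq_q; case/orP: (leq_total i j) => ?; [|apply/esym]; apply: W.
move=> eq_q; apply/eqP; rewrite eqn_leq le_ij leqNgt -subn_gt0.
apply/negP => /q_not_root_of_unity; rewrite -(inj_eq (mulfI (expf_neq0 i q_neq0))).
by rewrite -exprD subnKC // eq_q mulr1 eqxx.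
Qed.

Lemma one_sub_q_neq0 : 1 - q != 0.
Proof.
by rewrite subr_eq0 eq_sym -[q]expr1; apply: q_not_root_of_unity.
Qed.

(* The algebra morphism [A -> K[x, y]] whose kernel is [A z]. *)
Definition mod_a12 (a : A) : P := (nf a)`_0.

Lemma mod_a12D : {morph mod_a12 : a b / a + b}.
Proof. by move=> a b; rewrite /mod_a12 nfD coefD. Qed.

Lemma mod_a12Z c a : mod_a12 (c *: a) = c%:P%:P * mod_a12 a.
Proof. by rewrite /mod_a12 nfZ coefCM. Qed.

Lemma mod_a12_1 : mod_a12 1 = 1.
Proof. by rewrite /mod_a12 nf1 coef1. Qed.

(** A term of positive degree in the left factor contributes nothing in degree zero, so only the
    product of the constant coefficients survives. *)
Lemma mod_a12M : {morph mod_a12 : a b / a * b}.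
Proof.
move=> a b; rewrite /mod_a12 nfM coef_skew_mul.
have [->|nz_a] := eqVneq (nf a) 0; first by rewrite size_poly0 big_ord0 coef0 mul0r.
move: nz_a; rewrite -size_poly_gt0; case: (size _) => // n _.
by rewrite big_ord_recl /= big1 ?addr0 // => k _; rewrite mulr0.
Qed.

Lemma mod_a12_gen : [/\ mod_a12 x = 'X%:P, mod_a12 z = 0 & mod_a12 y = 'X].
Proof.
by rewrite /mod_a12; have [-> -> ->] := nf_gen q_neq0; rewrite !coefC coefX.
Qed.

(** Every element has the form [u z + f(x, y)], where [f] is its image under [mod_a12]; this is
    checked on ordered monomials. *)
Lemma mod_a12_eq0 a : mod_a12 a = 0 -> exists u, a = u * z.
Proof.
suff [u Ea] : exists u, a = u * z + poly_xy q (mod_a12 a).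
  by move=> a0; exists u; rewrite [LHS]Ea a0 poly_xy0 addr0.
elim/(Tq2_monom_ind q_neq0): a => [c a b [u Ea] [v Eb]|i j k].
  exists (c *: u + v); rewrite mod_a12D mod_a12Z poly_xyD poly_xyZ.
  by rewrite mulrDl -scalerAl addrACA -scalerDr -Ea -Eb.
rewrite /mod_a12 nf_monom coefCM coefXn; case: k => [|k]; rewrite ?eqxx.
  by exists 0; rewrite expr0 !mulr1 poly_xy_monom mul0r add0r.
by exists (x ^+ i * y ^+ j * z ^+ k); rewrite mulr0 poly_xy0 addr0 exprSr mulrA.
Qed.

Lemma mul_a12_inj a b : a * z = b * z -> a = b.
Proof.
move=> /(congr1 nf); rewrite !nf_mul_a12 => /(mulIf _) eq_ab.
by apply: (@nf_inj _ _ q_neq0); apply: eq_ab; rewrite polyX_eq0.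
Qed.

(** By degree in the skew variable, the normal forms of [a] and [b] are constants in [K[x][y]];
    units there lie in [K[x]], and units of [K[x]] lie in [K]. *)
Lemma Tq2_unit_scalar (a b : A) : a * b = 1 -> exists2 c : K, c != 0 & b = c%:A.
Proof.
move/(congr1 nf); rewrite nfM nf1 => ab1.
have [] := skew_mul_eq1 (@twist_inj _ _ q_neq0) ab1.
move=> /eqP/size_poly1P[f _ Ef] /eqP/size_poly1P[g _ Eg].
move: ab1; rewrite Ef Eg skew_mulCl -mul_polyC -polyCM => /polyC_inj fg1.
have: g \is a GRing.unit by apply/unitrP; exists f; rewrite fg1 mulrC.
rewrite poly_unitE => /andP[/size_poly1P[g' _ Eg']].
rewrite Eg' coefC poly_unitE => /andP[/size_poly1P[c nz_c Ec] _].
exists c => //; apply: (@nf_inj _ _ q_neq0).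
by rewrite nfZ nf1 mulr1 Eg Eg' Ec.
Qed.

Section Automorphism.
Variable phi : algAut A.
Local Notation psi := (algAut_inv phi).

Let phiB a b : phi (a - b) = phi a - phi b. Proof. exact: raddfB. Qed.
Let phiD a b : phi (a + b) = phi a + phi b. Proof. exact: raddfD. Qed.
Let phiM a b : phi (a * b) = phi a * phi b. Proof. exact: rmorphM. Qed.
Let phi1 : phi 1 = 1. Proof. exact: rmorph1. Qed.
Let phiZ c a : phi (c *: a) = c *: phi a. Proof. exact: linearZ. Qed.
Let phiK a : psi (phi a) = a. Proof. exact: algAut_funK. Qed.
Let psiK a : phi (psi a) = a. Proof. exact: algAut_invK. Qed.

(* Otherwise [phi x] and [phi y] vanish modulo [a12], so that [K[x, y]] is
   generated by the single polynomial [mod_a12 (phi z)]. *)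
Lemma mod_a12_phi : mod_a12 (phi z) = 0.
Proof.
apply/eqP/contraT; set W := mod_a12 _ => nz_W.
have [yz xz _] := Tq2_relations q.
(* Modulo [z], the image of the relation reads [(1 - q) m W = 0] in the domain [P], with
   [m = mod_a12 (phi a)]. *)
have kill a : a * z = q *: (z * a) -> mod_a12 (phi a) = 0.
  move=> /(congr1 (mod_a12 \o phi)); rewrite /= phiZ mod_a12Z !phiM !mod_a12M -/W.
  move=> /eqP; rewrite -subr_eq0 (mulrC _ W) -[X in X - _]mul1r -mulrBl.
  rewrite !mulf_eq0 (negbTE nz_W) /= -!polyC1 -!polyCB !polyC_eq0.
  by rewrite (negbTE one_sub_q_neq0) => /eqP.
have phix0 := kill _ xz; have phiy0 := kill _ yz.
have gen a : exists p, mod_a12 (phi a) = (C2 p).[W].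
  elim/Tq2_gen_ind: a => [|c a b [p Ep] [r Er]|a [p Ep]].
  - by exists 1; rewrite phi1 mod_a12_1 rmorph1 hornerC.
  - exists (c%:P * p + r); rewrite phiD phiZ mod_a12D mod_a12Z Ep Er.
    by rewrite rmorphD rmorphM /= map_polyC hornerD hornerCM.
  rewrite (phiM x) (phiM z) (phiM y) 3!(mod_a12M _ (phi a)) phix0 phiy0 Ep; split.
  - by exists 0; rewrite mul0r rmorph0 horner0.
  - by exists (p * 'X); rewrite rmorphM /= map_polyX hornerMX mulrC.
  - by exists 0; rewrite mul0r rmorph0 horner0.
have eval0 p : (C2 p).[W].[0] = p \Po W.[0].
  rewrite -[LHS]/(horner_eval 0 _) -horner_map /= -map_poly_comp.
  rewrite /comp_poly; congr (_.[_]).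
  by apply/eq_map_poly => c /=; rewrite /horner_eval hornerC.
have [mx _ my] := mod_a12_gen.
(* Setting [y = 0] gives [x = p(W(x, 0))], so [W(x, 0)] is not constant. For the second generator it
   gives [r(W(x, 0)) = 0], hence [r = 0] and then [y = 0], a contradiction. *)
have [p] := gen (psi x); rewrite psiK mx => /(congr1 (horner^~ 0)).
rewrite hornerC eval0 => Ep.
have [r] := gen (psi y); rewrite psiK my => Er.
have := congr1 (horner^~ 0) Er; rewrite hornerX eval0 => /esym/eqP.
rewrite comp_poly_eq0 => [/eqP r0|].
  by move/eqP: Er; rewrite r0 rmorph0 horner0 polyX_eq0.
rewrite ltnNge; apply: contra_eqN Ep => /size1_polyC ->.
by rewrite comp_polyCr; apply/eqP => /(congr1 (fun p : {poly K} => size p));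
  rewrite size_polyX size_polyC; case: (_ != 0).
Qed.
End Automorphism.

(** Write [phi z = u z] and [phi^-1 z = v z]. Then [z = phi (phi^-1 z) = phi(v) u z], and cancelling
    [z] makes [u] a unit, hence a scalar. *)
Lemma aut_a12 (phi : algAut A) : exists2 c : K, c != 0 & phi z = c *: z.
Proof.
have [u Eu] := mod_a12_eq0 (mod_a12_phi phi).
have [v Ev] := mod_a12_eq0 (mod_a12_phi (algAut_inv phi)).
rewrite -[algAut_fun _]/(algAut_inv_fun phi) in Ev.
have [|c nz_c Ec] := @Tq2_unit_scalar (phi v) u.
  apply: mul_a12_inj; rewrite -mulrA -Eu mul1r -[RHS](algAut_invK phi) Ev.
  exact/esym/rmorphM.
by exists c => //; rewrite Eu Ec -scalerAl mul1r.
Qed.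
End Structure.

(** * Elements that [q]-commute with [a12], and the images of [a11] and [a22] *)

Section DegreeOne.
Variables (K : fieldType) (q : K).
Hypothesis q_neq0 : q != 0.
Hypothesis q_not_root_of_unity : forall n, (0 < n)%N -> q ^+ n != 1.
Local Notation A := (Tq2 q).
Local Notation x := (a11 q).
Local Notation z := (a12 q).
Local Notation y := (a22 q).
Local Notation P := {poly {poly K}}.
Local Notation nf := (nf q_neq0).
Local Notation h := (horner_alg z).
Local Notation qX := (q^-1 *: 'X : {poly K}).
Local Notation qXP := (q^-1%:P%:P *: 'X : {poly P}).
Local Notation C2 := (map_poly (polyC \o polyC)).

(** By [deg1_exists] and [deg1_twist] these are exactly the elements [a] with [a z = q z a]. *)
Definition deg1 (p r : {poly K}) : A := x * h p + y * h r.

Lemma nf_horner_alg (p : {poly K}) : nf (h p) = C2 p.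
Proof.
elim/poly_ind: p => [|p c IH]; first by rewrite !rmorph0 nf0.
rewrite !rmorphD !rmorphM /= horner_algX horner_algC map_polyX map_polyC /=.
by rewrite nfD nf_mul_a12 IH nfZ nf1 mulr1.
Qed.

Lemma nf_deg1 p r : nf (deg1 p r) = 'X%:P%:P * C2 p + 'X%:P * C2 r.
Proof.
have [nfx _ nfy] := nf_gen q_neq0; rewrite /deg1 nfD.
by rewrite (nf_mulCl _ nfx) (nf_mulCl _ nfy) !nf_horner_alg.
Qed.

(* Evaluation of the coefficients, which are polynomials in [x] and [y]. *)
Definition eval_xy (a b : K) : {poly P} -> {poly K} :=
  map_poly (horner_eval a \o horner_eval b%:P).
HB.instance Definition _ a b := GRing.RMorphism.on (eval_xy a b).

Lemma eval_C2 a b p : eval_xy a b (C2 p) = p.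
Proof.
rewrite /eval_xy -map_poly_comp map_poly_id // => c _ /=.
by rewrite /horner_eval !hornerC.
Qed.

Lemma eval_nf_deg1 a b p r :
  eval_xy a b (nf (deg1 p r)) = a%:P * p + b%:P * r.
Proof.
rewrite nf_deg1 rmorphD !rmorphM /= !eval_C2 /eval_xy !map_polyC /=.
by rewrite /horner_eval !(hornerC, hornerX).
Qed.

Lemma deg1_inj p r p' r' : deg1 p r = deg1 p' r' -> p = p' /\ r = r'.
Proof.
move=> eq_d; split.
  have := congr1 (eval_xy 1 0 \o nf) eq_d.
  by rewrite /= !eval_nf_deg1 !mul0r !addr0 !mul1r.
have := congr1 (eval_xy 0 1 \o nf) eq_d.
by rewrite /= !eval_nf_deg1 !mul0r !add0r !mul1r.
Qed.

Lemma deg1D p r p' r' : deg1 p r + deg1 p' r' = deg1 (p + p') (r + r').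
Proof. by rewrite /deg1 addrACA -!mulrDr -!rmorphD. Qed.

Lemma deg1M p r s : deg1 p r * h s = deg1 (p * s) (r * s).
Proof. by rewrite /deg1 mulrDl -!mulrA -!rmorphM. Qed.

Lemma deg1C a b : deg1 a%:P b%:P = a *: x + b *: y.
Proof. by rewrite /deg1 !horner_algC -!scalerAr !mulr1. Qed.

(** Left multiplication by [z] twists the coefficients and shifts, right multiplication only shifts.
    Cancelling the shift makes the normal form an eigenvector of the twist. *)
Lemma nf_twist a : a * z = q *: (z * a) ->
  map_poly (twist q) (nf a) = q^-1%:P%:P *: nf a.
Proof.
move=> /(congr1 nf); rewrite nf_mul_a12 nfZ nfM.
have [_ -> _] := nf_gen q_neq0.
have nz_X : 'X != 0 :> {poly P} by rewrite polyX_eq0.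
rewrite skew_mulX mulrCA [LHS]mulrC => /(mulfI nz_X) Ea.
suff unscale (v w : {poly P}) : v = q%:P%:P%:P * w -> w = q^-1%:P%:P *: v.
  exact: unscale.
by move=> ->; rewrite mul_polyC scalerA -!polyCM mulVf // !polyC1 scale1r.
Qed.

(** The twist multiplies the coefficient of [x^i y^j] by [q^-(i+j)]. Powers of [q] being distinct,
    the eigenvalue [q^-1] leaves only [i + j = 1]. *)
Lemma deg1_exists a : a * z = q *: (z * a) -> exists p r, a = deg1 p r.
Proof.
move=> /nf_twist Tv; set v := nf a in Tv.
(* The successive indices of [v] are the exponents of [z], [y] and [x], so [p] collects the terms in
   [x z^k] and [r] those in [y z^k]. *)
pose p := \poly_(k < size v) v`_k`_0`_1; pose r := \poly_(k < size v) v`_k`_1`_0.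
exists p, r; apply: (@nf_inj _ _ q_neq0); rewrite nf_deg1 -/v.
have pE k : p`_k = v`_k`_0`_1.
  by rewrite coef_poly; case: ltnP => // ?; rewrite [v`_k]nth_default // !coef0.
have rE k : r`_k = v`_k`_1`_0.
  by rewrite coef_poly; case: ltnP => // ?; rewrite [v`_k]nth_default // !coef0.
have v0 k j i : (i + j)%N != 1%N -> v`_k`_j`_i = 0.
  move=> ne1; have /(congr1 (fun w : {poly P} => w`_k`_j`_i)) := Tv.
  rewrite coef_map /= coef_twist coefZ !coefCM => /eqP.
  rewrite -subr_eq0 -mulrBl mulf_eq0 subr_eq0 exprVn (inj_eq invr_inj).
  case/orP => /eqP // /(@expq_inj _ _ q_neq0 q_not_root_of_unity _ 1) eq1.
  by rewrite eq1 eqxx in ne1.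
apply/polyP => k; rewrite coefD !coefCM !coef_map /= pE rE.
apply/polyP => j; rewrite coefD coefCM coefC coefXM coefC.
apply/polyP => i; rewrite coefD.
case: j => [|[|j]] /=; rewrite ?mulr0 ?coef0 ?add0r ?addr0.
- rewrite coefXM coefC; case: i => [|[|i]] //=; exact: v0.
- by rewrite coefC; case: i => [|i] //=; apply: v0; rewrite addn1.
- by apply: v0; rewrite !addnS.
Qed.

Lemma deg1_twist p r : deg1 p r * z = q *: (z * deg1 p r).
Proof.
have [yz xz _] := Tq2_relations q.
have hz (s : {poly K}) : h s * z = z * h s.
  by have := congr1 h (mulrC s 'X); rewrite !rmorphM /= horner_algX.
have step g s : g * z = q *: (z * g) -> g * h s * z = q *: (z * (g * h s)).
  by move=> gz; rewrite -mulrA hz mulrA gz -scalerAl -mulrA.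
by rewrite /deg1 mulrDl (step x p xz) (step y r yz) -scalerDr -mulrDr.
Qed.

(** By [skew_mul_scaled] the product of two such normal forms is an ordinary one, with [z] replaced
    by [q^-1 z] in the left factor. Evaluating [(x, y)] at [(1, 0)] and [(0, 1)] separates the two
    equations. *)
Lemma deg1_comm p r p' r' : deg1 p r * deg1 p' r' = deg1 p' r' * deg1 p r ->
  (p \Po qX) * p' = (p' \Po qX) * p /\
  (r \Po qX) * r' = (r' \Po qX) * r.
Proof.
move=> /(congr1 nf); rewrite !nfM.
have scaled a b := nf_twist (deg1_twist a b).
rewrite !(skew_mul_scaled _ (twistC q _) (scaled _ _)).
have eval_comp a b v : eval_xy a b (v \Po qXP) =
    eval_xy a b v \Po qX.
  apply/polyP => k; rewrite coef_comp_scaleX !coef_map /= coef_comp_scaleX.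
  by rewrite !rmorphM !rmorphXn /= /horner_eval !hornerC.
move=> eq_v; split.
  have := congr1 (eval_xy 1 0) eq_v; rewrite !rmorphM /= !eval_comp !eval_nf_deg1.
  by rewrite !mul0r !addr0 !mul1r.
have := congr1 (eval_xy 0 1) eq_v; rewrite !rmorphM /= !eval_comp !eval_nf_deg1.
by rewrite !mul0r !add0r !mul1r.
Qed.

(** Comparing leading coefficients gives [q^-(deg p) = q^-(deg t)] for a nonzero solution [t]. All
    nonzero solutions thus have the same degree, so they form a line. *)
Lemma poly_proportional (p t : {poly K}) : p != 0 ->
  (p \Po qX) * t = (t \Po qX) * p -> exists c, t = c *: p.
Proof.
have size_eq (u : {poly K}) : p != 0 -> u != 0 ->
    (p \Po qX) * u = (u \Po qX) * p -> size u = size p.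
  have size_qX : size qX = 2.
    by rewrite size_scale ?invr_eq0 // size_polyX.
  move=> nz_p nz_u /(congr1 lead_coef).
  rewrite !lead_coefM !lead_coef_comp ?size_qX // lead_coefZ lead_coefX mulr1.
  rewrite mulrAC [RHS]mulrAC (mulrC (lead_coef u)).
  move=> /(mulfI _); rewrite mulf_neq0 ?lead_coef_eq0 // => /(_ isT).
  rewrite !exprVn => /invr_inj /(expq_inj q_neq0 q_not_root_of_unity).
  move: nz_p nz_u; rewrite -!size_poly_gt0.
  by case: (size p) (size u) => [|m] [|n] //= _ _ ->.
(* The scalar cancels the coefficient of degree [m = deg p]. The difference [u] is again a solution,
   and if nonzero it would have degree exactly [m]. *)
move=> nz_p eq_pt; pose m := (size p).-1; exists (t`_m / lead_coef p).
have nz_lp : lead_coef p != 0 by rewrite lead_coef_eq0.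
apply/eqP; rewrite -subr_eq0; set u := _ - _; apply/contraT => nz_u.
have um : u`_m = 0 by rewrite coefB coefZ -/(lead_coef p) divfK // subrr.
have /(size_eq _ nz_p nz_u) size_u : (p \Po qX) * u = (u \Po qX) * p.
  rewrite mulrBr eq_pt comp_polyB comp_polyZ mulrBl -scalerAl; congr (_ - _).
  by rewrite -scalerAr.
by move: nz_u; rewrite -lead_coef_eq0 lead_coefE size_u -/m um eqxx.
Qed.

Lemma poly_common_factor (p t : {poly K}) :
  (p \Po qX) * t = (t \Po qX) * p ->
  exists u a b, p = a *: u /\ t = b *: u.
Proof.
have [->|nz_p] := eqVneq p 0; first by exists t, 0, 1; rewrite scale0r scale1r.
by case/(poly_proportional nz_p) => c ->; exists p, 1, c; rewrite scale1r.
Qed.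

Lemma aut_horner_alg (phi : algAut A) c (p : {poly K}) : phi z = c *: z ->
  phi (h p) = h (p \Po (c *: 'X)).
Proof.
move=> phiz; elim/poly_ind: p => [|p d IH]; first by rewrite comp_poly0 !rmorph0.
rewrite comp_polyD comp_polyM comp_polyX comp_polyC !rmorphD !rmorphM /=.
rewrite IH !horner_algC !horner_algX phiz linearZ /= rmorph1; congr (_ * _ + _).
by rewrite -mul_polyC rmorphM /= horner_algC horner_algX -scalerAl mul1r.
Qed.

(** Since [phi z] is a nonzero multiple of [z], the images of [x] and [y] still [q]-commute with [z]
    and have the form [deg1]. Their commutation yields common factors [u] and [v], which
    surjectivity makes constant. *)
Lemma aut_generators (phi : algAut A) : exists (c : K) (M : 'M[K]_2),
  [/\ c != 0, phi z = c *: z, phi x = M 0 0 *: x + M 1 0 *: y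
    & phi y = M 0 1 *: x + M 1 1 *: y].
Proof.
have [c nz_c phiz] := aut_a12 q_neq0 q_not_root_of_unity phi.
have [c' nz_c' psiz] := aut_a12 q_neq0 q_not_root_of_unity (algAut_inv phi).
have [yz xz xy] := Tq2_relations q.
have image (f : algAut A) d a : d != 0 -> f z = d *: z -> a * z = q *: (z * a) ->
    exists p r, f a = deg1 p r.
  move=> nz_d fz az; apply: deg1_exists; apply: (scalerI nz_d).
  have := congr1 f az; rewrite linearZ /= !rmorphM /= fz => fa.
  by rewrite scalerAr fa -scalerAl !scalerA mulrC.
have [p [r phix]] := image phi c x nz_c phiz xz.
have [p' [r' phiy]] := image phi c y nz_c phiz yz.
have [s [t psix]] := image (algAut_inv phi) c' x nz_c' psiz xz.
have [s' [t' psiy]] := image (algAut_inv phi) c' y nz_c' psiz yz.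
have phi_deg1 a b : phi (deg1 a b) =
    deg1 (p * (a \Po (c *: 'X)) + p' * (b \Po (c *: 'X)))
         (r * (a \Po (c *: 'X)) + r' * (b \Po (c *: 'X))).
  by rewrite rmorphD !rmorphM /= !(aut_horner_alg _ phiz) phix phiy !deg1M deg1D.
have [|comm_p comm_r] := @deg1_comm p r p' r'.
  have := congr1 phi xy.
  by rewrite (rmorphM phi x y) (rmorphM phi y x) /= phix phiy.
have [u [a [b [Ep Ep']]]] := poly_common_factor comm_p.
have [v [a' [b' [Er Er']]]] := poly_common_factor comm_r.
have factor_const (w e : {poly K}) : w * e = 1 -> exists d, w = d%:P.
  move=> we1; have: w \is a GRing.unit by apply/unitrP; exists e; rewrite mulrC we1.
  by rewrite poly_unitE => /andP[/size_poly1P[d _ ->]]; exists d.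
(* The coefficient of [x] in [x = phi (phi^-1 x)] expresses [1] as a multiple of [u]; that of [y] in
   [y = phi (phi^-1 y)] does the same for [v]. *)
have [d Eu] : exists d, u = d%:P.
  have := congr1 phi psix; rewrite phi_deg1 (algAut_invK phi x).
  have -> : x = deg1 1%:P 0%:P by rewrite deg1C scale1r scale0r addr0.
  case/deg1_inj => + _; rewrite Ep Ep' -!scalerAl !scalerAr -mulrDr => /esym.
  exact: factor_const.
have [d' Ev] : exists d, v = d%:P.
  have := congr1 phi psiy; rewrite phi_deg1 (algAut_invK phi y).
  have -> : y = deg1 0%:P 1%:P by rewrite deg1C scale1r scale0r add0r.
  case/deg1_inj => _; rewrite Er Er' -!scalerAl !scalerAr -mulrDr => /esym.
  exact: factor_const.
exists c, (\matrix_(i, j) if i == 0 then (if j == 0 then a else b) * d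
                          else (if j == 0 then a' else b') * d').
split=> //; rewrite !mxE /= -deg1C.
  by rewrite phix Ep Er Eu Ev -!mul_polyC -!polyCM.
by rewrite phiy Ep' Er' Eu Ev -!mul_polyC -!polyCM.
Qed.
End DegreeOne.

(** * The automorphism group as pairs of a scalar and an invertible matrix *)

Definition GL_mx n (K : fieldType) (M : GL n K) : 'M[K]_n.-1.+1 := unitGroup_val M.

Lemma lin_comb2 (K : fieldType) (V : lmodType K) (u v : V) a b c d e f :
  e *: (a *: u + b *: v) + f *: (c *: u + d *: v) =
  (a * e + c * f) *: u + (b * e + d * f) *: v.
Proof.
rewrite !scalerDr !scalerA addrACA -!scalerDl.
by rewrite ![e * _]mulrC ![f * _]mulrC.
Qed.

Section AutomorphismGroup.
Variables (K : fieldType) (q : K).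
Hypothesis q_neq0 : q != 0.
Hypothesis q_not_root_of_unity : forall n, (0 < n)%N -> q ^+ n != 1.
Local Notation A := (Tq2 q).
Local Notation x := (a11 q).
Local Notation z := (a12 q).
Local Notation y := (a22 q).

(* The columns of [M] are the coordinates of [f a11] and [f a22]. *)
Definition linear_data (c : K) (M : 'M[K]_2) (f : A -> A) : Prop :=
  [/\ f z = c *: z, f x = M 0 0 *: x + M 1 0 *: y
    & f y = M 0 1 *: x + M 1 1 *: y].

(** Bijectivity is left out so that composites can be computed before an inverse is known. *)
Definition alg_endo (f : A -> A) : Prop := linear f /\ monoid_morphism f.

Lemma alg_endo_comp f g : alg_endo f -> alg_endo g -> alg_endo (f \o g).
Proof.
move=> [lf [f1 fM]] [lg [g1 gM]]; split=> [c a b|] /=; first by rewrite lg lf.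
by split=> [|a b] /=; rewrite ?g1 ?f1 // gM fM.
Qed.

Lemma alg_endo_aut (phi : algAut A) : alg_endo phi.
Proof. by case: (algAutP phi). Qed.

Lemma alg_endo_lin2 f c d a b : alg_endo f ->
  f (c *: a + d *: b) = c *: f a + d *: f b.
Proof.
move=> [lf _]; rewrite lf; congr (_ + _).
have f0 : f 0 = 0 by have := lf (-1) 0 0; rewrite scaler0 addr0 scaleN1r addNr.
by rewrite -[d *: b]addr0 lf f0 addr0.
Qed.

Lemma linear_data_id : linear_data 1 1%:M id.
Proof. by rewrite /linear_data !mxE /= !scale1r !scale0r addr0 add0r. Qed.

(** Because coordinates are stored in columns, composition corresponds to the matrix product in the
    same order. *)
Lemma linear_data_comp c M f d N g : alg_endo f ->
  linear_data c M f -> linear_data d N g -> linear_data (c * d) (M *m N) (f \o g).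
Proof.
move=> ef [fz fx fy] [gz gx gy]; split=> /=.
- have fZ : f (d *: z) = d *: f z.
    by have := alg_endo_lin2 d 0 z 0 ef; rewrite !scale0r !addr0.
  by rewrite gz fZ fz scalerA mulrC.
all: rewrite ?gx ?gy alg_endo_lin2 // fx fy !mxE !big_ord_recl !big_ord0 !addr0.
all: rewrite lin_comb2; congr (_ *: _ + _ *: _).
all: by congr (M _ _ * N _ _ + M _ _ * N _ _); apply: val_inj.
Qed.

Lemma linear_data_ext c M f g : alg_endo f -> alg_endo g ->
  linear_data c M f -> linear_data c M g -> f =1 g.
Proof.
move=> [lf [f1 fM]] [lg [g1 gM]] [fz fx fy] [gz gx gy].
elim/Tq2_gen_ind => [|d a b Ea Eb|a Ea]; first by rewrite f1 g1.
  by rewrite lf lg Ea Eb.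
by rewrite (fM x) (fM z) (fM y) (gM x) (gM z) (gM y) fx fy fz gx gy gz Ea.
Qed.

Lemma a12_neq0 : z != 0.
Proof.
apply/eqP => /(congr1 (nf q_neq0)); rewrite nf0.
by have [_ -> _] := nf_gen q_neq0; apply/eqP; rewrite polyX_eq0.
Qed.

Lemma linear_data_inj c M d N f :
  linear_data c M f -> linear_data d N f -> c = d /\ M = N.
Proof.
move=> [fz fx fy] [gz gx gy]; split.
  apply/eqP; rewrite -subr_eq0; apply/contraT => nz_cd.
  have/eqP := gz; rewrite fz -subr_eq0 -scalerBl => /eqP cd0.
  have : z = 0 by apply: (scalerI nz_cd); rewrite cd0 scaler0.
  by move/eqP; rewrite (negbTE a12_neq0).
have coord a b a' b' : a *: x + b *: y = a' *: x + b' *: y -> a = a' /\ b = b'.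
  by rewrite -!deg1C => /(deg1_inj q_neq0)[/polyC_inj -> /polyC_inj ->].
have [E00 E10] := coord _ _ _ _ (etrans (esym fx) gx).
have [E01 E11] := coord _ _ _ _ (etrans (esym fy) gy).
apply/matrixP => i j.
by case: i => [[|[|//]] ?]; case: j => [[|[|//]] ?];
  [move: E00|move: E01|move: E10|move: E11]; congr (M _ _ = N _ _); apply: val_inj.
Qed.

(** The relations persist: [q]-commutation with [z] passes to linear combinations of [x] and [y] and
    to multiples of [z], and any two such combinations commute. *)
Lemma endo_exists c M : exists2 f, alg_endo f & linear_data c M f.
Proof.
have [yz xz xy] := Tq2_relations q.
have central (d : K) (u : A) : in_alg A d * u = u * in_alg A d.
  by rewrite /= -scalerAl -scalerAr mul1r mulr1.
have comb_z a b : (a *: x + b *: y) * (c *: z) = q%:A * (c *: z * (a *: x + b *: y)).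
  rewrite -deg1C mulr_algl -[LHS]scalerAr deg1_twist -scalerAl !scalerA.
  by rewrite mulrC.
have comm_lin (u v : A) : GRing.comm u v -> forall d, GRing.comm u (d *: v).
  by move=> uv d; rewrite /GRing.comm -scalerAr [u * v]uv scalerAl.
have comm_xy a b u : GRing.comm u x -> GRing.comm u y ->
    GRing.comm u (a *: x + b *: y).
  by move=> ux uy; apply: commrD; apply: comm_lin.
have [F [FZ Fx Fz Fy]] := @Tq2_lift K q A (in_alg A)
  (M 0 0 *: x + M 1 0 *: y) (c *: z) (M 0 1 *: x + M 1 1 *: y) central
  (comb_z _ _) (comb_z _ _) (comm_xy _ _ _
    (commr_sym (comm_xy _ _ _ (commr_refl x) xy))
    (commr_sym (comm_xy _ _ _ (commr_sym xy) (commr_refl y)))).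
exists F => //; split; last by split; [apply: (rmorph1 F)|apply: (rmorphM F)].
move=> d a b; rewrite rmorphD FZ; congr (_ + _); exact: mulr_algl.
Qed.

Lemma aut_exists c M : c != 0 -> M \in unitmx ->
  exists phi : algAut A, linear_data c M phi.
Proof.
move=> nz_c unitM; have [f ef fP] := endo_exists c M.
(* The candidate inverse has the inverse data; both composites have the data of the identity, and
   data determine an endomorphism. *)
have [g eg gP] := endo_exists c^-1 (invmx M).
have fgK : f \o g =1 id.
  apply: (@linear_data_ext 1 1%:M) => //.
  - exact: alg_endo_comp.
  - by have := linear_data_comp ef fP gP; rewrite divff // mulmxV.
  - exact: linear_data_id.
have gfK : g \o f =1 id.
  apply: (@linear_data_ext 1 1%:M) => //.
  - exact: alg_endo_comp.
  - by have := linear_data_comp eg gP fP; rewrite mulVf // mulVmx.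
  - exact: linear_data_id.
have autf : `[< is_alg_aut f >].
  by apply/asboolP; case: ef => lf mf; split=> //; exists g.
by exists (AlgAut autf).
Qed.

Lemma aut_linear_data (phi : algAut A) :
  exists c M, [/\ c != 0, M \in unitmx & linear_data c M phi].
Proof.
have data (f : algAut A) : exists c M, c != 0 /\ linear_data c M f.
  have [c [M [nz_c fz fx fy]]] := aut_generators q_neq0 q_not_root_of_unity f.
  by exists c, M.
have [c [M [nz_c phiP]]] := data phi.
have [d [N [_ psiP]]] := data (algAut_inv phi).
exists c, M; split=> //.
(* Uniqueness of the data of [phi \o phi^-1 = id] gives [M *m N = 1], so [M] is invertible. *)
have := linear_data_comp (alg_endo_aut phi) phiP psiP.
have -> : phi \o algAut_inv phi = id by apply/funext => a; apply: algAut_invK.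
by case/(linear_data_inj linear_data_id) => _ /esym/mulmx1_unit[].
Qed.

Lemma aut_is_linear (phi : algAut A) : is_linear_aut phi.
Proof.
have incl (f : algAut A) (a : A) : Tq2_span q a -> Tq2_span q (f a).
  have [c [M [_ _ [fz fx fy]]]] := aut_linear_data f.
  move=> [a1 [a2 [a3 ->]]].
  exists (M 0 0 * a1 + M 0 1 * a3), (a2 * c), (M 1 0 * a1 + M 1 1 * a3).
  rewrite addrAC [in RHS]addrAC -lin_comb2 -fx -fy -scalerA -fz.
  have -> : f (a1 *: x + a3 *: y + a2 *: z) = f (a1 *: x + a3 *: y) + f (a2 *: z).
    exact: raddfD.
  by rewrite (alg_endo_lin2 _ _ _ _ (alg_endo_aut f)) linearZ.
apply/seteqP; split=> [_ [a a_span <-]|a a_span]; first exact: incl.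
exists (algAut_inv phi a); first exact: incl.
exact: algAut_invK.
Qed.

(** The group [G] is any copy of [K^*], identified through [f], so that [GL_1(K)] and [K^*] are
    handled together. *)
Lemma aut_group_isomorphic (G : groupType) (f : G -> K) :
  {morph f : a b / (a * b)%g >-> a * b} -> injective f ->
  (forall g, f g != 0) -> (forall c : K, c != 0 -> exists g, f g = c) ->
  group_isomorphic (algAut A) (G * GL 2 K)%type.
Proof.
move=> fM f_inj f_neq0 f_surj.
have data (phi : algAut A) : exists gM : (G * GL 2 K)%type,
    linear_data (f gM.1) (GL_mx gM.2) phi.
  have [c [M [nz_c unitM phiP]]] := aut_linear_data phi.
  by have [g Eg] := f_surj c nz_c; exists (g, UnitGroup unitM); rewrite /= Eg.
have [F FP] := choice data.
(* Data are unique, so the value of [F] is known as soon as some data are exhibited; this yields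
   multiplicativity and one of the two cancellations. *)
have F_eq (phi : algAut A) (g : G) (M : GL 2 K) :
    linear_data (f g) (GL_mx M) phi -> F phi = (g, M).
  move=> phiP; have [Eg EM] := linear_data_inj (FP phi) phiP.
  rewrite [LHS]surjective_pairing; congr (_, _); first exact: f_inj.
  exact: val_inj.
have FM : {morph F : a b / (a * b)%g}.
  move=> phi psi; apply: F_eq; rewrite fM.
  exact: linear_data_comp (alg_endo_aut phi) (FP phi) (FP psi).
pose F' : {multiplicative algAut A -> (G * GL 2 K)%type} :=
  HB.pack F (monoid.isMultiplicative.Build _ _ F FM).
exists F'.
have realize (gM : (G * GL 2 K)%type) :
    exists phi : algAut A, linear_data (f gM.1) (GL_mx gM.2) phi.
  by apply: aut_exists => //; apply: (valP gM.2).
have [H HP] := choice realize.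
exists H => [phi|[g M]]; last exact: (F_eq _ _ _ (HP (g, M))).
apply/val_inj/funext.
exact: linear_data_ext (alg_endo_aut _) (alg_endo_aut _) (HP _) (FP phi).
Qed.

End AutomorphismGroup.

Theorem theorem6p3 (K : fieldType) (charK : 2%N \notin [pchar K])
    (q : K) (q_neq0 : q != 0)
    (q_not_root_of_unity : forall n : nat, (0 < n)%N -> q ^+ n != 1) :
  [/\ forall phi : algAut (Tq2 q), is_linear_aut phi,
      group_isomorphic (algAut (Tq2 q)) (GL 1 K * GL 2 K)%type
    & group_isomorphic (algAut (Tq2 q)) (unitGroup K * GL 2 K)%type].
Proof.
split; first exact: aut_is_linear.
(* A matrix of size one is scalar, so its entry identifies [GL_1(K)] with [K^*]. *)
- pose entry (g : GL 1 K) : K := GL_mx g 0 0.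
  have entryE (g : GL 1 K) : GL_mx g = (entry g)%:M by apply: mx11_scalar.
  apply: (aut_group_isomorphic q_neq0 q_not_root_of_unity (f := entry)).
  + by move=> g k; rewrite /entry /= !mxE big_ord1.
  + move=> g k eq_gk; apply: val_inj.
    by rewrite -[LHS]/(GL_mx g) -[RHS]/(GL_mx k) !entryE eq_gk.
  + move=> g; have : GL_mx g \in unitmx by apply: valP g.
    rewrite entryE.
    by rewrite unitmxE det_scalar1 unitfE.
  + move=> c nz_c; have unit_c : (c%:M : 'M[K]_1) \in unitmx.
      by rewrite unitmxE det_scalar1 unitfE.
    by exists (UnitGroup unit_c : GL 1 K); rewrite /entry /= mxE eqxx.
- apply: (aut_group_isomorphic q_neq0 q_not_root_of_unity (f := @unitGroup_val K)).
  + by [].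
  + exact: val_inj.
  + by move=> g; have := valP g; rewrite unitfE.
  + by move=> c; rewrite -unitfE => unit_c; exists (UnitGroup unit_c).
Qed.
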